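(* Let $G$ be a finitely generated group with an Anosov-like action on the skew plane $P_{\mathrm{skew}}$, and let $\mathrm{Free}\subset G$ be the set of elements acting freely on $P_{\mathrm{skew}}$. Then for every finite generating set $S$ of $G$, $\lambda_S(\mathrm{Free})=\lambda_S(G)$, and moreover $$\limsup_{n\to\infty}\frac{|\mathrm{Free}\cap B_S(n)|}{|B_S(n)|}>0.$$
   Context: The skew plane $P_{\mathrm{skew}}$ is the strip $\{(x,y): x<y<x+1\}\subset\mathbb R^2$ with the foliations $\mathcal F^+,\mathcal F^-$ induced by the horizontal and vertical foliations of $\mathbb R^2$. An automorphism is a homeomorphism sending leaves of $\mathcal F^+$ to leaves of $\mathcal F^+$ and leaves of $\mathcal F^-$ to leaves of $\mathcal F^-$. An action of $G$ by automorphisms is Anosov-like if: (A1) if a nontrivial $g\in G$ fixes a leaf $l$ of $\mathcal F^+$ or $\mathcal F^-$, then it has a fixed point $x\in l$ and is topologically expanding on one leaf through $x$ and topologically contracting on the other; (A2) the union of $\mathcal F^+$-leaves fixed by some nontrivial element of $G$ is dense, and likewise for $\mathcal F^-$; (A3) each singular point is fixed by some nontrivial element (vacuous here); (A4) any leaf nonseparated in its leaf space from another leaf is fixed by some nontrivial element (vacuous here). For a finite generating set $S$, $B_S(n)$ is the word-metric ball of radius $n$ about the identity, and for $A\subset G$ the critical exponent is $\lambda_S(A)=\limsup_{n\to\infty}\frac1n\log|A\cap B_S(n)|$. *)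

(* Defs.v *)
From Stdlib Require Import Reals List ClassicalEpsilon.
From Coquelicot Require Import Coquelicot.
Open Scope R_scope.
Set Implicit Arguments.

Record group_axioms (G : Type) (mul : G -> G -> G) (inv : G -> G) (e : G) : Prop := {
  mul_assoc : forall a b c, mul a (mul b c) = mul (mul a b) c;
  mul_1l : forall a, mul e a = a;
  mul_Vl : forall a, mul (inv a) a = e
}.

Definition point := (R * R)%type.
Definition in_skew (p : point) : Prop := fst p < snd p < fst p + 1.

Definition pdist (p q : point) : R :=
  Rmax (Rabs (fst p - fst q)) (Rabs (snd p - snd q)).

Definition hleaf (c : R) : point -> Prop := fun p => snd p = c /\ in_skew p.
Definition vleaf (c : R) : point -> Prop := fun p => fst p = c /\ in_skew p.

Definition is_hleaf (l : point -> Prop) : Prop :=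
  exists c, (exists p, hleaf c p) /\ forall p, l p <-> hleaf c p.
Definition is_vleaf (l : point -> Prop) : Prop :=
  exists c, (exists p, vleaf c p) /\ forall p, l p <-> vleaf c p.

Definition image (f : point -> point) (A : point -> Prop) : point -> Prop :=
  fun q => exists p, A p /\ f p = q.

Definition set_eq (A B : point -> Prop) : Prop := forall p, A p <-> B p.

Definition continuous_on_skew (f : point -> point) : Prop :=
  forall p, in_skew p -> forall eps, 0 < eps -> exists delta, 0 < delta /\
    forall q, in_skew q -> pdist q p < delta -> pdist (f q) (f p) < eps.

(** Homeomorphism of P_skew (functions on R^2 considered only on the strip) *)
Definition skew_homeo (f : point -> point) : Prop :=
  (forall p, in_skew p -> in_skew (f p)) /\
  exists finv : point -> point,
    (forall p, in_skew p -> in_skew (finv p)) /\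
    (forall p, in_skew p -> finv (f p) = p) /\
    (forall p, in_skew p -> f (finv p) = p) /\
    continuous_on_skew f /\ continuous_on_skew finv.

Definition skew_automorphism (f : point -> point) : Prop :=
  skew_homeo f /\
  (forall l, is_hleaf l -> is_hleaf (image f l)) /\
  (forall l, is_vleaf l -> is_vleaf (image f l)).

Definition is_action (G : Type) (mul : G -> G -> G) (e : G)
    (act : G -> point -> point) : Prop :=
  (forall g, skew_automorphism (act g)) /\
  (forall p, in_skew p -> act e p = p) /\
  (forall g h p, in_skew p -> act (mul g h) p = act g (act h p)).

Definition fixes_leaf (f : point -> point) (l : point -> Prop) : Prop :=
  set_eq (image f l) l.

Definition seq_converges (u : nat -> point) (x : point) : Prop :=
  forall eps, 0 < eps -> exists N, forall n, (N <= n)%nat -> pdist (u n) x < eps.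

(** f is topologically contracting on the leaf l towards its fixed point x:
    f fixes l and x, and every point of l is attracted to x under forward
    iteration.  Expanding for g means contracting for g^{-1}. *)
Definition top_contracting (f : point -> point) (l : point -> Prop) (x : point) : Prop :=
  l x /\ f x = x /\ fixes_leaf f l /\
  forall y, l y -> seq_converges (fun n => Nat.iter n f y) x.

Definition anosov_like (G : Type) (inv : G -> G) (e : G)
    (act : G -> point -> point) : Prop :=
  (forall g, g <> e -> forall l, (is_hleaf l \/ is_vleaf l) -> fixes_leaf (act g) l ->
     exists x, l x /\ act g x = x /\
       ((top_contracting (act (inv g)) (hleaf (snd x)) x /\
         top_contracting (act g) (vleaf (fst x)) x) \/
        (top_contracting (act g) (hleaf (snd x)) x /\
         top_contracting (act (inv g)) (vleaf (fst x)) x))) /\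
  (forall p, in_skew p -> forall eps, 0 < eps -> exists q, pdist q p < eps /\
     exists g, g <> e /\ exists l, is_hleaf l /\ fixes_leaf (act g) l /\ l q) /\
  (forall p, in_skew p -> forall eps, 0 < eps -> exists q, pdist q p < eps /\
     exists g, g <> e /\ exists l, is_vleaf l /\ fixes_leaf (act g) l /\ l q).
  (* (A3), (A4) are vacuous for P_skew (no singular points, Hausdorff leaf spaces). *)

Definition acts_freely (act : point -> point) : Prop :=
  forall p, in_skew p -> act p <> p.

Fixpoint word_eval (G : Type) (mul : G -> G -> G) (inv : G -> G) (e : G)
    (w : list (bool * G)) : G :=
  match w with
  | nil => e
  | (b, s) :: w' => mul (if b then inv s else s) (word_eval mul inv e w')
  end.

Definition word_in (G : Type) (S : list G) (w : list (bool * G)) : Prop :=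
  forall l, In l w -> In (snd l) S.

Definition generates (G : Type) (mul : G -> G -> G) (inv : G -> G) (e : G)
    (S : list G) : Prop :=
  forall g, exists w, word_in S w /\ word_eval mul inv e w = g.

Definition word_ball (G : Type) (mul : G -> G -> G) (inv : G -> G) (e : G)
    (S : list G) (n : nat) : G -> Prop :=
  fun g => exists w, word_in S w /\ (length w <= n)%nat /\ word_eval mul inv e w = g.

Definition card (G : Type) (A : G -> Prop) : nat :=
  epsilon (inhabits 0%nat)
    (fun N => exists l : list G, NoDup l /\ length l = N /\ forall x, In x l <-> A x).

Definition crit_exp (G : Type) (mul : G -> G -> G) (inv : G -> G) (e : G)
    (S : list G) (A : G -> Prop) : Rbar :=
  LimSup_seq (fun n => ln (INR (card (fun g => A g /\ word_ball mul inv e S n g))) / INR n).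

(* Main.v *)
Require Import Defs.
From Stdlib Require Import Reals ZArith List Lra Lia ClassicalEpsilon.
From Coquelicot Require Import Coquelicot.
Open Scope R_scope.

(** An element [g] acts by [(x, y) |-> (phi_g x, psi_g y)] with [phi_g] a homeomorphism
    of the line; if [phi_g] is increasing, then [psi_g = phi_g] commutes with
    [x |-> x + 1].  Suppose some increasing [phi_h] moves a point down by at least [1].
    Then [t = h h] satisfies [phi_t x < x - 1] for all [x], whereas an increasing [phi_g]
    with a fixed point satisfies [phi_g x < x + 1]; hence for increasing [g] one of [g],
    [t g] is free.  A fixed orientation-reversing [r] handles the remaining [g], so
    finitely many left translates of the free elements cover [G], which gives a lower
    bound on the proportion of free elements in every large ball.

    If there were no such [h], the supremum [s] of an orbit would be fixed by the whole
    increasing subgroup.  By (A1) on the leaf [x = s], every nontrivial increasing element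
    is attracting or repelling on [(s, s + 1)].  Comparing germs at [s + 1] then gives an
    archimedean bi-invariant order, so by Hoelder the subgroup is abelian and its
    nontrivial elements share one fixed point in [(s, s + 1)], against (A2). *)

(** * Archimedean ordered groups *)

Section Group.

Context {G : Type} {mul : G -> G -> G} {inv : G -> G} {e : G}.
Context (HG : group_axioms mul inv e).

Lemma mulA (a b c : G) : mul (mul a b) c = mul a (mul b c).
Proof. symmetry; apply HG. Qed.

Lemma mul1g (a : G) : mul e a = a.
Proof. apply HG. Qed.

Lemma mulVg (a : G) : mul (inv a) a = e.
Proof. apply HG. Qed.

Lemma mulKg (a b : G) : mul (inv a) (mul a b) = b.
Proof. now rewrite <- mulA, mulVg, mul1g. Qed.

Lemma mul_cancel_l (a b c : G) : mul a b = mul a c -> b = c.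
Proof. intros E. now rewrite <- (mulKg a b), E, mulKg. Qed.

Lemma mulg1 (a : G) : mul a e = a.
Proof. apply (mul_cancel_l (inv a)). now rewrite mulKg, mulVg. Qed.

Lemma mulgV (a : G) : mul a (inv a) = e.
Proof. apply (mul_cancel_l (inv a)). now rewrite mulKg, mulg1. Qed.

Lemma mulVKg (a b : G) : mul a (mul (inv a) b) = b.
Proof. now rewrite <- mulA, mulgV, mul1g. Qed.

Lemma invgK (a : G) : inv (inv a) = a.
Proof. apply (mul_cancel_l (inv a)). now rewrite mulgV, mulVg. Qed.

Lemma invg1 : inv e = e.
Proof. apply (mul_cancel_l e). now rewrite mulgV, mul1g. Qed.

Lemma invMg (a b : G) : inv (mul a b) = mul (inv b) (inv a).
Proof.
  apply (mul_cancel_l (mul a b)).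
  now rewrite mulgV, mulA, mulVKg, mulgV.
Qed.

Ltac grp :=
  repeat first [rewrite mulA | rewrite invMg | rewrite mulKg | rewrite mulVKg
               | rewrite mulVg | rewrite mulgV | rewrite mul1g | rewrite mulg1
               | rewrite invgK | rewrite invg1].

Fixpoint gpow (a : G) (n : nat) : G :=
  match n with O => e | S n => mul a (gpow a n) end.

Lemma gpow_add (a : G) (m n : nat) : gpow a (m + n) = mul (gpow a m) (gpow a n).
Proof. induction m as [|m IH]; simpl; [now grp | now rewrite IH; grp]. Qed.

Section Hoelder.

(* [P] is the positive cone of an order on the subgroup [H]. *)
Context (H P : G -> Prop).
Context (H_mul : forall a b, H a -> H b -> H (mul a b)).
Context (H_inv : forall a, H a -> H (inv a)).
Context (H_one : H e).
Context (P_total : forall a, H a -> a = e \/ P a \/ P (inv a)).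
Context (P_one : ~ P e).
Context (P_mul : forall a b, H a -> H b -> P a -> P b -> P (mul a b)).
Context (P_conj : forall g a, H g -> H a -> P a -> P (mul (mul (inv g) a) g)).

Definition glt (a b : G) : Prop := H a /\ H b /\ P (mul (inv a) b).
Definition gle (a b : G) : Prop := H a /\ H b /\ (a = b \/ P (mul (inv a) b)).

Context (P_arch : forall a c, H a -> H c -> P a -> P c -> exists n, glt c (gpow a n)).

Lemma gpow_closed (a : G) (n : nat) : H a -> H (gpow a n).
Proof. intros Ha; induction n; simpl; auto. Qed.

Lemma glt_gle (a b : G) : glt a b -> gle a b.
Proof. intros (? & ? & ?); repeat split; auto. Qed.

Lemma gle_lt_trans (a b c : G) : gle a b -> glt b c -> glt a c.
Proof.
  intros (Ha & Hb & [->|Pab]) (_ & Hc & Pbc); [now repeat split |].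
  repeat split; auto.
  replace (mul (inv a) c) with (mul (mul (inv a) b) (mul (inv b) c)) by now grp.
  apply P_mul; auto.
Qed.

Lemma glt_le_trans (a b c : G) : glt a b -> gle b c -> glt a c.
Proof.
  intros Hab (Hb & Hc & [<-|Pbc]); [exact Hab |].
  apply gle_lt_trans with b; [apply glt_gle, Hab | now repeat split].
Qed.

Lemma gle_trans (a b c : G) : gle a b -> gle b c -> gle a c.
Proof.
  intros Hab (Hb & Hc & [<-|Pbc]); [exact Hab |].
  apply glt_gle, gle_lt_trans with b; [exact Hab | now repeat split].
Qed.

Lemma glt_irrefl (a : G) : ~ glt a a.
Proof. intros (_ & _ & Pa). apply P_one. now rewrite mulVg in Pa. Qed.

Lemma glt_or_gle (a b : G) : H a -> H b -> glt a b \/ gle b a.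
Proof.
  intros Ha Hb.
  destruct (P_total (mul (inv a) b)) as [E|[Pab|Pba]]; auto.
  - right; repeat split; auto; left.
    now rewrite <- (mulVKg a b), E, mulg1.
  - left; now repeat split.
  - right; repeat split; auto; right.
    now rewrite invMg, invgK in Pba.
Qed.

Lemma glt_mul_l (g a b : G) : H g -> glt a b -> glt (mul g a) (mul g b).
Proof.
  intros Hg (Ha & Hb & Pab); repeat split; auto.
  now rewrite invMg, mulA, mulKg.
Qed.

Lemma gle_mul_l (g a b : G) : H g -> gle a b -> gle (mul g a) (mul g b).
Proof.
  intros Hg (Ha & Hb & [->|Pab]); [repeat split; auto |].
  apply glt_gle, glt_mul_l; [exact Hg | now repeat split].
Qed.

Lemma gle_mul_r (g a b : G) : H g -> gle a b -> gle (mul a g) (mul b g).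
Proof.
  intros Hg (Ha & Hb & [->|Pab]); repeat split; auto.
  right. generalize (P_conj g (mul (inv a) b) Hg (H_mul _ _ (H_inv _ Ha) Hb) Pab).
  now grp.
Qed.

Lemma gle_mul (a b c d : G) : gle a b -> gle c d -> gle (mul a c) (mul b d).
Proof.
  intros Hab Hcd.
  apply gle_trans with (mul b c).
  - apply gle_mul_r; [apply Hcd | exact Hab].
  - apply gle_mul_l; [apply Hab | exact Hcd].
Qed.

Lemma gpow_floor (x a : G) : H x -> H a -> P x -> P a ->
  exists m, gle (gpow x m) a /\ glt a (gpow x (S m)).
Proof.
  intros Hx Ha Px Pa.
  destruct (P_arch x a Hx Ha Px Pa) as [n Hn].
  revert Hn; induction n as [|n IH]; intros Hn.
  - exfalso; apply (glt_irrefl a), gle_lt_trans with e; [apply glt_gle, Hn |].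
    repeat split; auto. now rewrite invg1, mul1g.
  - destruct (glt_or_gle a (gpow x n)) as [Hlt|Hle]; auto using gpow_closed.
    now exists n.
Qed.

(** Suppose [k], the quotient of [a c] by [c a], is positive. If some positive [z] has [z z <= k],
    squeeze [a] and [c] between consecutive powers [z^m], [z^(m+1)] and [z^l], [z^(l+1)]: then
    [a c < z^(l+m+2) <= c a k = a c]. Such a [z] is missing only when [k] is the least positive
    element. *)
Lemma positive_commute_not_lt (a c : G) : H a -> H c -> P a -> P c ->
  ~ glt (mul c a) (mul a c).
Proof.
  intros Ha Hc Pa Pc (_ & _ & Pk).
  set (k := mul (inv (mul c a)) (mul a c)) in Pk.
  assert (Hk : H k) by (unfold k; auto).
  assert (Ek : mul a c = mul (mul c a) k) by (unfold k; now grp).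
  assert (Pe : forall x, P x -> H x -> glt e x).
  { intros x Px Hx; repeat split; auto. now rewrite invg1, mul1g. }
  destruct (classic (exists x, H x /\ P x /\ glt x k)) as [(x & Hx & Px & _ & _ & Pxk)|Hmin].
  (* Write [k = x y] with both factors positive; the smaller factor has its square below [k]. *)
  - assert (Hsq : exists z, H z /\ P z /\ gle (mul z z) k).
    { set (y := mul (inv x) k) in Pxk.
      assert (Hy : H y) by (unfold y; auto).
      assert (Exy : k = mul x y) by (unfold y; now grp).
      destruct (glt_or_gle x y Hx Hy) as [Hlt|Hle].
      - exists x; repeat split; auto.
        rewrite Exy. apply gle_mul_l, glt_gle; auto.
      - exists y; repeat split; auto. rewrite Exy. apply gle_mul_r; auto. }
    destruct Hsq as (z & Hz & Pz & Hzk).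
    destruct (gpow_floor z a) as (m & Hm1 & Hm2); auto.
    destruct (gpow_floor z c) as (l & Hl1 & Hl2); auto.
    apply (glt_irrefl (mul a c)).
    apply glt_le_trans with (mul a (gpow z (S l))).
    { apply glt_mul_l; auto. }
    apply gle_trans with (mul (gpow z (S m)) (gpow z (S l))).
    { apply gle_mul_r, glt_gle; auto using gpow_closed. }
    rewrite <- gpow_add.
    replace (S m + S l)%nat with ((l + m) + 2)%nat by lia.
    rewrite !gpow_add, Ek. apply gle_mul; [now apply gle_mul |].
    simpl. now rewrite mulg1.
  - (* [k] is then the least positive element, so [a] and [c] are powers of [k]. *)
    assert (Hpow : forall b, H b -> P b -> exists m, b = gpow k m).
    { intros b Hb Pb.
      destruct (gpow_floor k b) as (m & (Hm & _ & [E|Pm]) & Hm2); auto.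
      - now exists m.
      (* Otherwise the remainder [k^-m b] would be positive and smaller than [k]. *)
      - exfalso; apply Hmin. exists (mul (inv (gpow k m)) b).
        repeat split; auto.
        destruct Hm2 as (_ & _ & Pm2).
        replace (mul (inv (mul (inv (gpow k m)) b)) k)
          with (mul (inv b) (gpow k (S m))); auto.
        rewrite <- (Nat.add_1_r m), gpow_add; simpl; now grp. }
    destruct (Hpow a) as [m Em]; auto. destruct (Hpow c) as [l El]; auto.
    apply P_one. replace e with k; auto.
    unfold k. rewrite Em, El, <- !gpow_add, (Nat.add_comm l m). apply mulVg.
Qed.

Lemma positive_commute (a c : G) : H a -> H c -> P a -> P c -> mul a c = mul c a.
Proof.
  intros Ha Hc Pa Pc.
  destruct (glt_or_gle (mul a c) (mul c a)) as [Hlt|(_ & _ & [E|Plt])]; auto.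
  - now apply positive_commute_not_lt in Hlt.
  - exfalso; apply (positive_commute_not_lt a c); auto. now repeat split; auto.
Qed.

Lemma commute_inv (a c : G) : mul (inv a) c = mul c (inv a) -> mul a c = mul c a.
Proof.
  intros E. apply (mul_cancel_l (inv a)).
  rewrite mulKg, <- mulA, E. now grp.
Qed.

(* Hoelder's theorem on archimedean bi-ordered groups. *)
Lemma archimedean_commute (a c : G) : H a -> H c -> mul a c = mul c a.
Proof.
  assert (Hr : forall a c, H a -> H c -> P a -> mul a c = mul c a).
  { intros b d Hb Hd Pb. destruct (P_total d Hd) as [->|[Pd|Pd]].
    - now grp.
    - now apply positive_commute.
    - symmetry; apply commute_inv; symmetry; apply positive_commute; auto. }
  intros Ha Hc. destruct (P_total a Ha) as [->|[Pa|Pa]].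
  - now grp.
  - now apply Hr.
  - apply commute_inv; auto.
Qed.

End Hoelder.
End Group.

(** * Dynamics on the line *)

(** The interval [(s, s + 1)] is the vertical leaf over [s], parametrized by height; this is the
    convergence part of topological contraction on that leaf. *)
Definition attracts (f : R -> R) (s p : R) : Prop :=
  forall y, s < y < s + 1 -> is_lim_seq (fun n => Nat.iter n f y) p.

Lemma strict_increasing_le (f : R -> R) (x y : R) : strict_increasing f -> x <= y -> f x <= f y.
Proof. intros Hf [Hxy| ->]; [left; now apply Hf | lra]. Qed.

Lemma strict_increasing_lt_inv (f : R -> R) (x y : R) :
  strict_increasing f -> f x < f y -> x < y.
Proof.
  intros Hf Hxy. apply Rnot_le_lt; intros Hle.
  apply (strict_increasing_le _ _ _ Hf) in Hle. lra.
Qed.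

Lemma strict_increasing_le_inv (f : R -> R) (x y : R) :
  strict_increasing f -> f x <= f y -> x <= y.
Proof. intros Hf Hxy. apply Rnot_lt_le; intros Hlt. apply Hf in Hlt. lra. Qed.

(** If [y <= f y], monotonicity keeps all iterates of [y] above [y], so they cannot converge to
    [p < y]. *)
Lemma attracts_moves_down (f : R -> R) (s p y : R) : strict_increasing f -> attracts f s p ->
  s < y < s + 1 -> p < y -> f y < y.
Proof.
  intros Hf Hp Hy Hpy.
  destruct (Rlt_le_dec (f y) y) as [|Hle]; [assumption | exfalso].
  assert (Hit : forall n, y <= Nat.iter n f y).
  { induction n as [|n IH]; simpl; [lra |].
    apply Rle_trans with (f y); [lra | now apply strict_increasing_le]. }
  assert (Hlim := is_lim_seq_le _ _ _ _ Hit (is_lim_seq_const y) (Hp y Hy)).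
  simpl in Hlim; lra.
Qed.

Lemma attracts_moves_up (f : R -> R) (s p y : R) : strict_increasing f -> attracts f s p ->
  s < y < s + 1 -> y < p -> y < f y.
Proof.
  intros Hf Hp Hy Hpy.
  destruct (Rlt_le_dec y (f y)) as [|Hle]; [assumption | exfalso].
  assert (Hit : forall n, Nat.iter n f y <= y).
  { induction n as [|n IH]; simpl; [lra |].
    apply Rle_trans with (f y); [now apply strict_increasing_le | lra]. }
  assert (Hlim := is_lim_seq_le _ _ _ _ Hit (Hp y Hy) (is_lim_seq_const y)).
  simpl in Hlim; lra.
Qed.

Lemma attracts_fixed (f : R -> R) (s p y : R) : attracts f s p ->
  s < y < s + 1 -> f y = y -> p = y.
Proof.
  intros Hp Hy Ey.
  assert (Hlim : is_lim_seq (fun _ => y) p).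
  { apply is_lim_seq_ext with (2 := Hp y Hy).
    induction n as [|n IH]; simpl; [reflexivity | now rewrite IH]. }
  apply is_lim_seq_unique in Hlim. rewrite Lim_seq_const in Hlim. now injection Hlim.
Qed.

Lemma is_lim_seq_lt_eventually (u : nat -> R) (l a : R) : is_lim_seq u l -> l < a ->
  exists N, forall n, (N <= n)%nat -> u n < a.
Proof.
  intros Hu Hl. apply is_lim_seq_spec in Hu.
  assert (H0 : 0 < a - l) by lra.
  destruct (Hu (mkposreal _ H0)) as [N HN]; exists N; intros n Hn.
  specialize (HN n Hn); simpl in HN. apply Rabs_def2 in HN; lra.
Qed.

Lemma is_lim_seq_gt_eventually (u : nat -> R) (l a : R) : is_lim_seq u l -> a < l ->
  exists N, forall n, (N <= n)%nat -> a < u n.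
Proof.
  intros Hu Hl. apply is_lim_seq_spec in Hu.
  assert (H0 : 0 < l - a) by lra.
  destruct (Hu (mkposreal _ H0)) as [N HN]; exists N; intros n Hn.
  specialize (HN n Hn); simpl in HN. apply Rabs_def2 in HN; lra.
Qed.

Section LineAction.

Context {G : Type} {mul : G -> G -> G} {inv : G -> G} {e : G}.
Context (HG : group_axioms mul inv e).
Context (phi : G -> R -> R).
Context (phi_mul : forall g h x, phi (mul g h) x = phi g (phi h x)).
Context (phi_one : forall x, phi e x = x).

Lemma phi_inv_l (g : G) (x : R) : phi (inv g) (phi g x) = x.
Proof. now rewrite <- phi_mul, (mulVg HG), phi_one. Qed.

Lemma phi_inv_r (g : G) (x : R) : phi g (phi (inv g) x) = x.
Proof. now rewrite <- phi_mul, (mulgV HG), phi_one. Qed.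

Lemma strict_increasing_one : strict_increasing (phi e).
Proof. intros x y. now rewrite !phi_one. Qed.

Lemma strict_increasing_mul (g h : G) :
  strict_increasing (phi g) -> strict_increasing (phi h) -> strict_increasing (phi (mul g h)).
Proof. intros Hg Hh x y Hxy. rewrite !phi_mul. auto. Qed.

Lemma strict_increasing_inv (g : G) : strict_increasing (phi g) -> strict_increasing (phi (inv g)).
Proof.
  intros Hg x y Hxy. apply (strict_increasing_lt_inv (phi g)); [assumption |].
  now rewrite !phi_inv_r.
Qed.

Lemma strict_increasing_gpow (a : G) (n : nat) :
  strict_increasing (phi a) -> strict_increasing (phi (gpow (mul := mul) (e := e) a n)).
Proof. intros Ha. induction n; simpl; auto using strict_increasing_one, strict_increasing_mul. Qed.

Lemma phi_inv_pow (a : G) (n : nat) (y : R) :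
  phi (inv (gpow (mul := mul) (e := e) a n)) y = Nat.iter n (phi (inv a)) y.
Proof.
  revert y; induction n as [|n IH]; intros y; simpl.
  - now rewrite (invg1 HG), phi_one.
  - rewrite (invMg HG), phi_mul, IH. now rewrite <- Nat.iter_succ_r.
Qed.

(** These three hypotheses carry the geometry: the shape of the strip, (A1) on vertical leaves, and
    (A2) for vertical leaves with an orientation-preserving stabilizing element. *)
Context (phi_period : forall g x, strict_increasing (phi g) -> phi g (x + 1) = phi g x + 1).
Context (phi_attr : forall g s, g <> e -> strict_increasing (phi g) -> phi g s = s ->
  exists p, s < p < s + 1 /\ (attracts (phi g) s p \/ attracts (phi (inv g)) s p)).
Context (phi_dense : forall x eps, 0 < eps -> exists c, Rabs (c - x) < eps /\
  exists g, g <> e /\ strict_increasing (phi g) /\ phi g c = c).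

(** * Excluding a common fixed point of the increasing subgroup *)

Section GlobalFixedPoint.

Context (s : R).
Context (phi_fix : forall g, strict_increasing (phi g) -> phi g s = s).

Lemma phi_interval (g : G) (y : R) : strict_increasing (phi g) ->
  s < y < s + 1 -> s < phi g y < s + 1.
Proof.
  intros Hg [Hy1 Hy2]. apply Hg in Hy1. apply Hg in Hy2.
  rewrite (phi_period g s Hg), (phi_fix g Hg) in *. lra.
Qed.

(** The positive cone of the order by germs on the left of [s + 1]. It is conjugation invariant
    because increasing elements preserve [(s, s + 1)]. *)
Definition germ_pos (g : G) : Prop :=
  exists v, s < v < s + 1 /\ forall y, v <= y < s + 1 -> y < phi g y.

Lemma germ_pos_one : ~ germ_pos e.
Proof.
  intros (v & Hv & Hpos). specialize (Hpos v ltac:(lra)). rewrite phi_one in Hpos. lra.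
Qed.

Lemma germ_pos_mul (g h : G) : strict_increasing (phi g) -> strict_increasing (phi h) ->
  germ_pos g -> germ_pos h -> germ_pos (mul g h).
Proof.
  intros Hg Hh (v & Hv & Hgv) (w & Hw & Hhw). exists (Rmax v w).
  split; [apply Rmax_case; lra |].
  intros y Hy. pose proof (Rmax_l v w). pose proof (Rmax_r v w).
  rewrite phi_mul.
  assert (y < phi h y) by (apply Hhw; lra).
  destruct (phi_interval h y Hh ltac:(lra)).
  apply Rlt_trans with (phi h y); [assumption |]. apply Hgv; lra.
Qed.

Lemma germ_pos_conj (g a : G) : strict_increasing (phi g) -> strict_increasing (phi a) ->
  germ_pos a -> germ_pos (mul (mul (inv g) a) g).
Proof.
  intros Hg Ha (v & Hv & Hav). pose proof (strict_increasing_inv g Hg) as Hg'.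
  exists (phi (inv g) v). split; [now apply phi_interval |].
  intros y Hy. destruct (phi_interval (inv g) v Hg' Hv).
  destruct (phi_interval g y Hg ltac:(lra)).
  assert (Hgy : v <= phi g y).
  { rewrite <- (phi_inv_r g v). apply strict_increasing_le; [assumption | lra]. }
  rewrite !phi_mul. rewrite <- (phi_inv_l g y) at 1. apply Hg', Hav. lra.
Qed.

(** The inverse moves every point above [p] down, so [g] moves it up. The midpoint of [p] and
    [s + 1] is taken because [germ_pos] includes the endpoint [v], which must differ from [p]. *)
Lemma germ_pos_of_attracts (g : G) (p : R) : strict_increasing (phi g) -> s < p < s + 1 ->
  attracts (phi (inv g)) s p -> germ_pos g.
Proof.
  intros Hg Hp Hat. pose proof (strict_increasing_inv g Hg) as Hg'.
  exists ((p + s + 1) / 2); split; [lra |]. intros y Hy.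
  rewrite <- (phi_inv_r g y) at 1. apply Hg.
  apply attracts_moves_down with s p; auto; lra.
Qed.

Lemma germ_pos_not_inv (g : G) : strict_increasing (phi g) -> germ_pos g -> ~ germ_pos (inv g).
Proof.
  intros Hg Pg Pg'. apply germ_pos_one. rewrite <- (mulgV HG g).
  apply germ_pos_mul; auto using strict_increasing_inv.
Qed.

(** A germ order is in general only partial, since a map may oscillate near [s + 1]; the attracting
    or repelling dynamics of [phi_attr] excludes this. *)
Lemma germ_pos_total (g : G) : strict_increasing (phi g) ->
  g = e \/ germ_pos g \/ germ_pos (inv g).
Proof.
  intros Hg. destruct (classic (g = e)) as [|Hne]; auto.
  destruct (phi_attr g s Hne Hg (phi_fix g Hg)) as (p & Hp & [Hat|Hat]); right.
  - right; apply germ_pos_of_attracts with p; auto using strict_increasing_inv.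
    now rewrite (invgK HG).
  - left; now apply germ_pos_of_attracts with p.
Qed.

(* With [p] the repelling fixed point of [a] and [u < p < v], for large [n] the
   element [a^-n c] moves [u] up and [v] down, so it is attracting. *)
Lemma germ_pos_arch (a c : G) : strict_increasing (phi a) -> strict_increasing (phi c) ->
  germ_pos a -> germ_pos c ->
  exists n, glt (mul := mul) (inv := inv) (fun g => strict_increasing (phi g)) germ_pos
              c (gpow (mul := mul) (e := e) a n).
Proof.
  intros Ha Hc Pa Pc.
  assert (Hne : a <> e) by (intros ->; now apply germ_pos_one).
  destruct (phi_attr a s Hne Ha (phi_fix a Ha)) as (p & Hp & [Hat|Hat]).
  { exfalso; apply (germ_pos_not_inv a); auto.
    apply germ_pos_of_attracts with p; auto using strict_increasing_inv.
    now rewrite (invgK HG). }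
  set (u := (s + p) / 2). set (v := (p + s + 1) / 2).
  assert (Huv : s < u < p /\ p < v < s + 1) by (unfold u, v; lra).
  destruct (is_lim_seq_lt_eventually _ p v (Hat (phi c v)
    (phi_interval c v Hc ltac:(lra))) ltac:(lra)) as [N1 HN1].
  destruct (is_lim_seq_gt_eventually _ p u (Hat (phi c u)
    (phi_interval c u Hc ltac:(lra))) ltac:(lra)) as [N2 HN2].
  exists (N1 + N2)%nat.
  specialize (HN1 (N1 + N2)%nat ltac:(lia)). specialize (HN2 (N1 + N2)%nat ltac:(lia)).
  set (an := gpow a (N1 + N2)).
  assert (Han : strict_increasing (phi an)) by now apply strict_increasing_gpow.
  set (k := mul (inv an) c).
  assert (Hk : strict_increasing (phi k))
    by (unfold k; auto using strict_increasing_mul, strict_increasing_inv).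
  assert (Hkv : phi k v < v) by (unfold k, an; now rewrite phi_mul, phi_inv_pow).
  assert (Hku : u < phi k u) by (unfold k, an; now rewrite phi_mul, phi_inv_pow).
  repeat split; auto.
  (* So the goal is that [inv k] is germ-positive, which holds once [k] is attracting. *)
  replace (mul (inv c) an) with (inv k)
    by (unfold k; now rewrite (invMg HG), (invgK HG)).
  assert (Hkne : k <> e) by (intros E; rewrite E, phi_one in Hku; lra).
  destruct (phi_attr k s Hkne Hk (phi_fix k Hk)) as (q & Hq & [Hkat|Hkat]).
  - apply germ_pos_of_attracts with q; auto using strict_increasing_inv.
    now rewrite (invgK HG).
  (* If [q] were repelling for [k], then [k] would move [v] up (when [q < v]) or [u] down (when
     [u < q]). *)
  - exfalso. pose proof (strict_increasing_inv k Hk) as Hk'.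
    destruct (Rlt_le_dec q v) as [Hqv|Hqv].
    + assert (Hm := attracts_moves_down _ s q v Hk' Hkat ltac:(lra) Hqv).
      apply Hk in Hm. rewrite phi_inv_r in Hm. lra.
    + assert (Hm := attracts_moves_up _ s q u Hk' Hkat ltac:(lra) ltac:(lra)).
      apply Hk in Hm. rewrite phi_inv_r in Hm. lra.
Qed.

Lemma global_fixed_point_abelian (a b : G) :
  strict_increasing (phi a) -> strict_increasing (phi b) -> mul a b = mul b a.
Proof.
  intros Ha Hb.
  apply (archimedean_commute HG (fun g => strict_increasing (phi g)) germ_pos); auto using
    strict_increasing_mul, strict_increasing_inv, strict_increasing_one,
    germ_pos_total, germ_pos_one,
    germ_pos_mul, germ_pos_conj, germ_pos_arch.
Qed.

(** Let [a] attract to [p], and let [b] fix some [q] in [(s, p)]. Then [a] moves [q], but since [b]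
    commutes with [a] it also fixes the image of [q]. Two fixed points of [b] in [(s, s + 1)]
    contradict [attracts_fixed]. *)
Lemma no_global_fixed_point : False.
Proof.
  assert (Ha : exists a p, strict_increasing (phi a) /\ s < p < s + 1 /\ attracts (phi a) s p).
  (* Here density only serves to produce a nontrivial increasing element. *)
  { destruct (phi_dense 0 1 ltac:(lra)) as (_ & _ & g & Hne & Hg & _).
    destruct (phi_attr g s Hne Hg (phi_fix g Hg)) as (p & Hp & [Hat|Hat]).
    - now exists g, p.
    - exists (inv g), p; auto using strict_increasing_inv. }
  destruct Ha as (a & p & Ha & Hp & Hat).
  (* The ball with this center and radius is exactly [(s, p)]. *)
  destruct (phi_dense ((s + p) / 2) ((p - s) / 2) ltac:(lra))
    as (q & Hq & b & Hne & Hb & Eq).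
  apply Rabs_def2 in Hq.
  assert (Hup : q < phi a q) by (apply attracts_moves_up with s p; auto; lra).
  assert (Ebaq : phi b (phi a q) = phi a q).
  { rewrite <- phi_mul, <- (global_fixed_point_abelian a b), phi_mul, Eq; auto. }
  destruct (phi_interval a q Ha ltac:(lra)) as [Haq1 Haq2].
  assert (Hinv : forall x, phi b x = x -> phi (inv b) x = x).
  { intros x Ex. rewrite <- Ex at 1. apply phi_inv_l. }
  destruct (phi_attr b s Hne Hb (phi_fix b Hb)) as (r & Hr & [Hbat|Hbat]).
  - assert (r = q) by (apply (attracts_fixed _ s r q Hbat); auto; lra).
    assert (r = phi a q) by (apply (attracts_fixed _ s r _ Hbat); auto; lra). lra.
  - assert (r = q) by (apply (attracts_fixed _ s r q Hbat); auto; lra).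
    assert (r = phi a q) by (apply (attracts_fixed _ s r _ Hbat); auto; lra). lra.
Qed.

End GlobalFixedPoint.

(* If no orientation-preserving element moved a point by at least [1], the
   supremum of an orbit would be a global fixed point. *)
Lemma exists_large_displacement :
  exists h x, strict_increasing (phi h) /\ phi h x <= x - 1.
Proof.
  apply NNPP; intros Hno.
  assert (Hlow : forall h x, strict_increasing (phi h) -> x - 1 < phi h x).
  { intros h x Hh. destruct (Rlt_le_dec (x - 1) (phi h x)) as [|Hle]; [assumption |].
    exfalso; apply Hno. now exists h, x. }
  set (E := fun y => exists g, strict_increasing (phi g) /\ y = phi g 0).
  assert (Hbd : bound E).
  { exists 1. intros y (g & Hg & ->).
    generalize (Hlow (inv g) (phi g 0) (strict_increasing_inv g Hg)). rewrite phi_inv_l. lra. }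
  assert (HE : exists y, E y) by (exists (phi e 0), e; auto using strict_increasing_one).
  destruct (completeness E Hbd HE) as (s & Hub & Hleast).
  (* The orbit is invariant under [h], so [phi (inv h) s] is again an upper bound and is at least
     [s]; apply [phi h]. *)
  assert (Hle : forall h, strict_increasing (phi h) -> phi h s <= s).
  { intros h Hh. rewrite <- (phi_inv_r h s) at 2.
    apply strict_increasing_le; [assumption |]. apply Hleast.
    intros y (g & Hg & ->). rewrite <- (phi_inv_l h (phi g 0)).
    apply strict_increasing_le; [now apply strict_increasing_inv |].
    apply Hub. exists (mul h g). split; [now apply strict_increasing_mul |].
    now rewrite phi_mul. }
  apply (no_global_fixed_point s). intros g Hg. apply Rle_antisym; [now apply Hle |].
  rewrite <- (phi_inv_r g s) at 1.
  apply strict_increasing_le; [assumption |]. now apply Hle, strict_increasing_inv.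
Qed.

(** * Displacement of maps commuting with the unit translation *)

Lemma phi_shift (g : G) (x : R) (n : nat) : strict_increasing (phi g) ->
  phi g (x + INR n) = phi g x + INR n.
Proof.
  intros Hg. induction n as [|n IH]; [simpl; now rewrite !Rplus_0_r |].
  rewrite S_INR, <- Rplus_assoc, phi_period, IH by assumption. lra.
Qed.

(** The integer part of [y - x] is split into two naturals because [phi_shift] handles natural
    shifts only. *)
Lemma integer_translate (x y : R) :
  exists n m, x + INR n <= y + INR m < x + INR n + 1.
Proof.
  destruct (archimed (y - x)) as [H1 H2]. set (z := up (y - x)) in *.
  exists (Z.to_nat (z - 1)), (Z.to_nat (1 - z)).
  destruct (Z.le_gt_cases 1 z) as [Hz|Hz].
  - replace (Z.to_nat (1 - z)) with O by lia.
    rewrite INR_IZR_INZ, Z2Nat.id, minus_IZR by lia. simpl. lra.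
  - replace (Z.to_nat (z - 1)) with O by lia.
    rewrite (INR_IZR_INZ (Z.to_nat (1 - z))), Z2Nat.id, minus_IZR by lia. simpl. lra.
Qed.

(** By periodicity [h] moves every [x0 + k] down by at least [1]. A point of [[x0 + n, x0 + n + 1)]
    therefore falls below [x0 + n] after one application of [h] and below [x0 + n - 1] after two, a
    drop of more than [1]. *)
Lemma exists_translating :
  exists t, strict_increasing (phi t) /\ forall x, phi t x < x - 1.
Proof.
  destruct exists_large_displacement as (h & x0 & Hh & Hx0).
  exists (mul h h). split; [now apply strict_increasing_mul |]. intros x.
  destruct (integer_translate x0 x) as (n & m & Hnm).
  assert (E : forall k, phi h (x0 + INR k) <= x0 + INR k - 1).
  { intros k. rewrite phi_shift by assumption. lra. }
  assert (H1 : phi h x + INR m < x0 + INR n).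
  { rewrite <- phi_shift by assumption.
    apply Rlt_le_trans with (phi h (x0 + INR n + 1)); [apply Hh; lra |].
    rewrite phi_period by assumption. generalize (E n). lra. }
  apply Hh in H1. rewrite phi_shift in H1 by assumption.
  rewrite phi_mul. generalize (E n). lra.
Qed.

(** All integer translates of [c] are fixed, and the image of [x] stays below the first of them
    above [x]. *)
Lemma fixed_point_displacement (g : G) (c x : R) : strict_increasing (phi g) ->
  phi g c = c -> phi g x < x + 1.
Proof.
  intros Hg Ec. destruct (integer_translate c x) as (n & m & Hnm).
  assert (H1 : phi g (x + INR m) < phi g (c + INR n + 1)) by (apply Hg; lra).
  rewrite phi_period, !phi_shift, Ec in H1 by assumption. lra.
Qed.

End LineAction.

(** * Automorphisms of the skew plane *)

Lemma Rmin_Rmax_opposite (a b : R) : a * b <= 0 -> Rmin a b <= 0 <= Rmax a b.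
Proof.
  intros Hab. unfold Rmin, Rmax.
  destruct (Rle_dec a b); split; apply Rnot_lt_le; intros Hlt; nra.
Qed.

Lemma continuous_injective_monotone (f : R -> R) : continuity f ->
  (forall x y, f x = f y -> x = y) ->
  strict_increasing f \/ (forall x y, x < y -> f y < f x).
Proof.
  intros Hc Hinj.
  (* The chord from (0,1) to (x,y) stays off the diagonal, so f(b) - f(a) has
     constant sign along it. *)
  assert (Hsign : forall x y, x < y -> 0 < (f 1 - f 0) * (f y - f x)).
  { intros x y Hxy.
    set (h := fun t => f (1 + t * (y - 1)) - f (t * x)).
    assert (Hh : continuity h).
    { unfold h. apply continuity_minus; apply (continuity_comp _ f); auto; reg. }
    assert (Hh0 : h 0 = f 1 - f 0) by (unfold h; do 2 f_equal; f_equal; ring).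
    assert (Hh1 : h 1 = f y - f x) by (unfold h; do 2 f_equal; f_equal; ring).
    rewrite <- Hh0, <- Hh1.
    destruct (Rlt_le_dec 0 (h 0 * h 1)) as [|Hle]; [assumption | exfalso].
    destruct (IVT_gen h 0 1 0 Hh) as (t & Ht & Et).
    - now apply Rmin_Rmax_opposite.
    - rewrite Rmin_left, Rmax_right in Ht by lra. unfold h in Et.
      assert (E : 1 + t * (y - 1) = t * x) by (apply Hinj; lra).
      (* [E] reads [t (y - x) = t - 1]; with [0 <= t <= 1] this forces [t = 1], and then [y = x]. *)
      assert (Hp : 0 <= t * (y - x)) by (apply Rmult_le_pos; lra).
      assert (t = 1) as -> by lra. lra. }
  assert (f 1 <> f 0) by (intros E; apply Hinj in E; lra).
  destruct (Rlt_le_dec (f 0) (f 1)); [left | right];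
    intros x y Hxy; specialize (Hsign x y Hxy); nra.
Qed.

(** The induced maps on the two leaf spaces, each identified with the line and evaluated at leaf
    midpoints. *)
Definition base_map (f : point -> point) (x : R) : R := fst (f (x, x + 1 / 2)).
Definition height_map (f : point -> point) (y : R) : R := snd (f (y - 1 / 2, y)).

Lemma in_skew_pair (x y : R) : in_skew (x, y) <-> x < y < x + 1.
Proof. reflexivity. Qed.

Lemma vleaf_is_vleaf (c : R) : is_vleaf (vleaf c).
Proof.
  exists c; split; [| reflexivity].
  exists (c, c + 1 / 2). split; [reflexivity | apply in_skew_pair; lra].
Qed.

Lemma hleaf_is_hleaf (c : R) : is_hleaf (hleaf c).
Proof.
  exists c; split; [| reflexivity].
  exists (c - 1 / 2, c). split; [reflexivity | apply in_skew_pair; lra].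
Qed.

(** The image of a vertical leaf lies in one vertical leaf, so the first coordinate of [f p] depends
    on that of [p] alone and may be read off at the midpoint; likewise for heights. *)
Lemma automorphism_split (f : point -> point) (p : point) : skew_automorphism f ->
  in_skew p -> f p = (base_map f (fst p), height_map f (snd p)).
Proof.
  intros (_ & Hh & Hv) Hp. destruct p as [x y].
  destruct (Hv _ (vleaf_is_vleaf x)) as (c & _ & Hc).
  destruct (Hh _ (hleaf_is_hleaf y)) as (d & _ & Hd).
  assert (Hc' : forall z, in_skew (x, z) -> fst (f (x, z)) = c).
  { intros z Hz. apply (Hc (f (x, z))). exists (x, z). now repeat split; try apply Hz. }
  assert (Hd' : forall z, in_skew (z, y) -> snd (f (z, y)) = d).
  { intros z Hz. apply (Hd (f (z, y))). exists (z, y). now repeat split; try apply Hz. }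
  unfold base_map, height_map; cbn [fst snd].
  rewrite !Hc', !Hd'; try (apply in_skew_pair; lra).
  rewrite <- (Hc' y Hp), <- (Hd' x Hp). apply surjective_pairing.
Qed.

Lemma base_map_continuity (f : point -> point) : skew_automorphism f ->
  continuity (base_map f).
Proof.
  intros ((_ & finv & _ & _ & _ & Hc & _) & _) x eps Heps.
  assert (Hx : forall z, in_skew (z, z + 1 / 2)) by (intros z; apply in_skew_pair; lra).
  destruct (Hc (x, x + 1 / 2) (Hx x) eps Heps) as (d & Hd & Hcd).
  exists d; split; [assumption |]. intros z [_ Hz].
  eapply Rle_lt_trans; [| apply (Hcd (z, z + 1 / 2)); auto].
  - unfold pdist, base_map. apply Rmax_l.
  - unfold pdist; simpl in *; unfold Rdist in Hz.
    replace (z + 1 / 2 - (x + 1 / 2)) with (z - x) by ring.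
    now rewrite Rmax_left by lra.
Qed.

(** * The induced actions on the leaf spaces *)

Section SkewAction.

Context {G : Type} {mul : G -> G -> G} {inv : G -> G} {e : G}.
Context (HG : group_axioms mul inv e).
Context (act : G -> point -> point) (Hact : is_action mul e act).

Definition phi (g : G) : R -> R := base_map (act g).
Definition psi (g : G) : R -> R := height_map (act g).

Lemma act_split (g : G) (x y : R) : x < y < x + 1 -> act g (x, y) = (phi g x, psi g y).
Proof. intros Hxy. apply (automorphism_split _ (x, y)); [apply Hact | apply Hxy]. Qed.

Lemma act_in_skew (g : G) (p : point) : in_skew p -> in_skew (act g p).
Proof. apply Hact. Qed.

Lemma act_mul (g h : G) (p : point) : in_skew p -> act (mul g h) p = act g (act h p).
Proof. apply Hact. Qed.

Lemma phi_psi_band (g : G) (x y : R) :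
  x < y < x + 1 -> phi g x < psi g y < phi g x + 1.
Proof.
  intros Hxy. generalize (act_in_skew g (x, y) Hxy). now rewrite act_split.
Qed.

Lemma phi_mul (g h : G) (x : R) : phi (mul g h) x = phi g (phi h x).
Proof.
  unfold phi at 1, base_map.
  assert (Hx : x < x + 1 / 2 < x + 1) by lra.
  rewrite act_mul, act_split, act_split by auto using phi_psi_band. reflexivity.
Qed.

Lemma psi_mul (g h : G) (y : R) : psi (mul g h) y = psi g (psi h y).
Proof.
  unfold psi at 1, height_map.
  assert (Hy : y - 1 / 2 < y < y - 1 / 2 + 1) by lra.
  rewrite act_mul, act_split, act_split by auto using phi_psi_band. reflexivity.
Qed.

Lemma phi_one (x : R) : phi e x = x.
Proof.
  unfold phi, base_map. destruct Hact as (_ & He & _).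
  rewrite He; [reflexivity | apply in_skew_pair; lra].
Qed.

Lemma psi_one (x : R) : psi e x = x.
Proof.
  unfold psi, height_map. destruct Hact as (_ & He & _).
  rewrite He; [reflexivity | apply in_skew_pair; lra].
Qed.

Lemma psi_inv_l (g : G) (y : R) : psi (inv g) (psi g y) = y.
Proof. now rewrite <- psi_mul, (mulVg HG), psi_one. Qed.

(** A vertical and a horizontal leaf meet exactly when their images do; this incidence relation
    links [psi] to [phi]. *)
Lemma phi_psi_band_iff (g : G) (x y : R) :
  phi g x < psi g y < phi g x + 1 <-> x < y < x + 1.
Proof.
  split; [intros H | apply phi_psi_band].
  apply (phi_psi_band (inv g)) in H.
  now rewrite (phi_inv_l HG phi phi_mul phi_one), psi_inv_l in H.
Qed.

Lemma phi_monotone (g : G) :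
  strict_increasing (phi g) \/ (forall x y, x < y -> phi g y < phi g x).
Proof.
  apply continuous_injective_monotone.
  - apply base_map_continuity, Hact.
  - intros x y E. rewrite <- (phi_inv_l HG phi phi_mul phi_one g x), E.
    apply (phi_inv_l HG phi phi_mul phi_one).
Qed.

(** The leaf of height [y] meets the vertical leaves over [(y - 1, y)]. An increasing [phi g]
    preserves the right endpoint of this interval; the left endpoint yields [phi_period]. *)
Lemma psi_eq_phi (g : G) (y : R) : strict_increasing (phi g) -> psi g y = phi g y.
Proof.
  intros Hg.
  destruct (Rtotal_order (psi g y) (phi g y)) as [Hlt|[E|Hgt]]; [| assumption |]; exfalso.
  - assert (Hmid : phi g (y - 1 / 2) < phi g y) by (apply Hg; lra).
    assert (Hm : psi g y <= Rmax (psi g y) (phi g (y - 1 / 2)) < phi g y)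
      by (split; [apply Rmax_l | now apply Rmax_lub_lt]).
    pose proof (Rmax_r (psi g y) (phi g (y - 1 / 2))) as Hr.
    set (m := Rmax _ _) in *.
    assert (Em := phi_inv_r HG phi phi_mul phi_one g m). set (x := phi (inv g) m) in *.
    assert (x < y) by (apply (strict_increasing_lt_inv _ _ _ Hg); lra).
    assert (y - 1 / 2 <= x) by (apply (strict_increasing_le_inv _ _ _ Hg); lra).
    generalize (phi_psi_band g x y). lra.
  - assert (Hmid : phi g (y - 1 / 2) < phi g y) by (apply Hg; lra).
    destruct (Rlt_le_dec (psi g y) (phi g y + 1)) as [H|H].
    + generalize (proj1 (phi_psi_band_iff g y y)). lra.
    + generalize (phi_psi_band g (y - 1 / 2) y). lra.
Qed.

Lemma phi_period (g : G) (x : R) : strict_increasing (phi g) -> phi g (x + 1) = phi g x + 1.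
Proof.
  intros Hg.
  assert (Epsi := psi_eq_phi g (x + 1) Hg).
  assert (Hx1 : phi g x < phi g (x + 1)) by (apply Hg; lra).
  destruct (Rtotal_order (phi g (x + 1)) (phi g x + 1)) as [Hlt|[E|Hgt]];
    [| assumption |]; exfalso.
  - generalize (proj1 (phi_psi_band_iff g x (x + 1))). lra.
  (* Some [z] slightly above [x] still has [phi g z + 1 <= psi g (x + 1)], although [(z, x + 1)]
     lies in the strip. *)
  - assert (Hmid : phi g x < phi g (x + 1 / 2)) by (apply Hg; lra).
    assert (Hm : phi g x < Rmin (psi g (x + 1) - 1) (phi g (x + 1 / 2)))
      by (apply Rmin_glb_lt; lra).
    pose proof (Rmin_l (psi g (x + 1) - 1) (phi g (x + 1 / 2))) as Hl.
    pose proof (Rmin_r (psi g (x + 1) - 1) (phi g (x + 1 / 2))) as Hr.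
    set (m := Rmin _ _) in *.
    assert (Em := phi_inv_r HG phi phi_mul phi_one g m). set (z := phi (inv g) m) in *.
    assert (x < z) by (apply (strict_increasing_lt_inv _ _ _ Hg); lra).
    assert (z <= x + 1 / 2) by (apply (strict_increasing_le_inv _ _ _ Hg); lra).
    generalize (phi_psi_band g z (x + 1)). lra.
Qed.

Lemma iter_act (g : G) (c y : R) (n : nat) : strict_increasing (phi g) -> phi g c = c ->
  c < y < c + 1 -> Nat.iter n (act g) (c, y) = (c, Nat.iter n (phi g) y) /\
    c < Nat.iter n (phi g) y < c + 1.
Proof.
  intros Hg Ec Hy. induction n as [|n [IH1 IH2]]; [now split |].
  assert (E : Nat.iter (S n) (act g) (c, y) = (c, Nat.iter (S n) (phi g) y)).
  { simpl. rewrite IH1, act_split, psi_eq_phi, Ec; auto. }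
  split; [assumption |]. change (in_skew (c, Nat.iter (S n) (phi g) y)).
  rewrite <- E. change (in_skew (act g (Nat.iter n (act g) (c, y)))).
  apply act_in_skew.
  now rewrite IH1.
Qed.

Lemma top_contracting_attracts (g : G) (x : point) : strict_increasing (phi g) ->
  top_contracting (act g) (vleaf (fst x)) x -> attracts (phi g) (fst x) (snd x).
Proof.
  intros Hg ([_ Hx] & Efix & _ & Hconv) y Hy.
  assert (Ec : phi g (fst x) = fst x).
  { destruct x as [c d]. rewrite act_split in Efix by assumption. now injection Efix. }
  apply is_lim_seq_spec. intros eps.
  destruct (Hconv (fst x, y) (conj eq_refl Hy) eps (cond_pos eps)) as [N HN].
  exists N. intros n Hn. apply Rle_lt_trans with (2 := HN n Hn).
  destruct (iter_act g (fst x) y n Hg Ec Hy) as [-> _]. unfold pdist; simpl. apply Rmax_r.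
Qed.

Lemma fixes_vleaf_iff (g : G) (c : R) : fixes_leaf (act g) (vleaf c) <-> phi g c = c.
Proof.
  assert (Hc : c < c + 1 / 2 < c + 1) by lra.
  split.
  - intros Hfix. assert (Himg : vleaf c (act g (c, c + 1 / 2))).
    { apply Hfix. exists (c, c + 1 / 2). now repeat split; try apply Hc. }
    rewrite act_split in Himg by assumption. apply Himg.
  - intros Ec p. split.
    + intros ([x y] & [Ex Hxy] & <-). simpl in Ex; subst x. split.
      * now rewrite act_split.
      * now apply act_in_skew.
    + destruct p as [x y]. intros [Ex Hxy]. simpl in Ex; subst x.
      exists (act (inv g) (c, y)). repeat split.
      * rewrite act_split by assumption. cbn [fst].
        rewrite <- Ec at 1. apply (phi_inv_l HG phi phi_mul phi_one).
      * now apply act_in_skew.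
      * now apply act_in_skew.
      * rewrite <- act_mul, (mulgV HG) by assumption. now apply Hact.
Qed.

(** Under an involution the even iterates of a point of the leaf other than [x] stay put and do not
    converge to [x]. *)
Lemma top_contracting_not_involution (g : G) (x : point) :
  top_contracting (act g) (vleaf (fst x)) x -> mul g g <> e.
Proof.
  intros ([_ Hx] & _ & _ & Hconv) E. destruct x as [c d].
  set (y := (c + d) / 2). cbn [fst snd] in *.
  assert (Hd : c < d < c + 1) by apply Hx.
  assert (Hy : in_skew (c, y)) by (apply in_skew_pair; unfold y; lra).
  assert (Hit : forall n, Nat.iter (n + n) (act g) (c, y) = (c, y)).
  { induction n as [|n IH]; [reflexivity |]. rewrite Nat.add_succ_r; simpl.
    rewrite IH, <- act_mul, E by assumption. now apply Hact. }
  destruct (Hconv (c, y) (conj eq_refl Hy) (d - y)) as [N HN]; [unfold y; lra |].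
  specialize (HN (N + N)%nat ltac:(lia)). rewrite Hit in HN.
  apply (Rle_lt_trans _ _ _ (Rmax_r _ _)) in HN. simpl in HN.
  apply Rabs_def2 in HN. lra.
Qed.

Context (HA : anosov_like inv e act).

Lemma anosov_vleaf (g : G) (c : R) : g <> e -> phi g c = c ->
  exists p, c < p < c + 1 /\
    (top_contracting (act g) (vleaf c) (c, p) \/
     top_contracting (act (inv g)) (vleaf c) (c, p)).
Proof.
  intros Hne Ec. destruct HA as (H1 & _).
  destruct (H1 g Hne (vleaf c) (or_intror (vleaf_is_vleaf c)))
    as ([x p] & [Ex Hp] & _ & Hcon); [now apply fixes_vleaf_iff |].
  simpl in Ex; subst x. exists p; split; [apply Hp |].
  destruct Hcon as [[_ Hcon]|[_ Hcon]]; auto.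
Qed.

Lemma phi_attr (g : G) (s : R) : g <> e -> strict_increasing (phi g) -> phi g s = s ->
  exists p, s < p < s + 1 /\ (attracts (phi g) s p \/ attracts (phi (inv g)) s p).
Proof.
  intros Hne Hg Es. destruct (anosov_vleaf g s Hne Es) as (p & Hp & Hcon).
  exists p; split; [assumption |].
  destruct Hcon as [Hcon|Hcon]; [left | right];
    apply (top_contracting_attracts _ (s, p)); auto.
  now apply (strict_increasing_inv HG phi phi_mul phi_one).
Qed.

Lemma decreasing_mul (g h : G) :
  ~ strict_increasing (phi g) -> ~ strict_increasing (phi h) -> strict_increasing (phi (mul g h)).
Proof.
  intros Hg Hh x y Hxy. rewrite !phi_mul.
  destruct (phi_monotone g) as [|Dg]; [tauto |].
  destruct (phi_monotone h) as [|Dh]; [tauto |]. now apply Dg, Dh.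
Qed.

(** The element given by (A2) may reverse orientation. Its square then preserves orientation, fixes
    the same leaf, and is nontrivial because by (A1) the element or its inverse contracts that
    leaf. *)
Lemma phi_dense (x eps : R) : 0 < eps -> exists c, Rabs (c - x) < eps /\
  exists g, g <> e /\ strict_increasing (phi g) /\ phi g c = c.
Proof.
  intros Heps. destruct HA as (_ & _ & H3).
  destruct (H3 (x, x + 1 / 2) ltac:(apply in_skew_pair; lra) eps Heps)
    as (q & Hq & g & Hne & l & (c & _ & Hl) & Hfix & Hlq).
  exists (fst q). apply Hl in Hlq as [Ec Hskew]. rewrite Ec. split.
  { rewrite <- Ec. apply Rle_lt_trans with (2 := Hq). apply Rmax_l. }
  assert (Efix : phi g c = c).
  { apply fixes_vleaf_iff. intros p. rewrite <- (Hl p), <- (Hfix p). split.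
    - intros (z & Hz & Ez). exists z. split; [now apply Hl | assumption].
    - intros (z & Hz & Ez). exists z. split; [now apply Hl | assumption]. }
  destruct (classic (strict_increasing (phi g))) as [Hg|Hg]; [now exists g |].
  exists (mul g g). repeat split.
  - destruct (anosov_vleaf g c Hne Efix) as (p & _ & [Hcon|Hcon]).
    + now apply (top_contracting_not_involution g (c, p)).
    + apply (top_contracting_not_involution (inv g) (c, p)) in Hcon.
      intros E. apply Hcon. now rewrite <- (invMg HG), E, (invg1 HG).
  - now apply decreasing_mul.
  - now rewrite phi_mul, Efix.
Qed.

Lemma not_free_fixed (g : G) : ~ acts_freely (act g) -> exists c, phi g c = c.
Proof.
  intros Hnf. apply NNPP; intros Hno. apply Hnf. intros [x y] Hxy E.
  apply Hno. exists x. rewrite act_split in E by assumption. now injection E.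
Qed.

Lemma free_of_no_fixed (g : G) : (forall x, phi g x <> x) -> acts_freely (act g).
Proof.
  intros Hno. apply NNPP; intros Hnf. destruct (not_free_fixed g Hnf) as [c Ec].
  now apply (Hno c).
Qed.

Lemma finitely_many_translates_free :
  exists F : list G, forall g, exists f, In f F /\ acts_freely (act (mul f g)).
Proof.
  destruct (exists_translating HG phi phi_mul phi_one phi_period phi_attr phi_dense)
    as (t & Ht & Htx).
  assert (Hinc : forall g, strict_increasing (phi g) ->
    acts_freely (act g) \/ acts_freely (act (mul t g))).
  { intros g Hg. destruct (classic (acts_freely (act g))) as [|Hnf]; auto.
    right. destruct (not_free_fixed g Hnf) as [c Ec].
    apply free_of_no_fixed. intros x. rewrite phi_mul.
    (* Here [phi t (phi g x) < phi g x - 1 < x]. *)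
    generalize (Htx (phi g x))
      (fixed_point_displacement phi phi_period g c x Hg Ec). lra. }
  destruct (classic (exists r, ~ strict_increasing (phi r))) as [[r Hr]|Hall].
  - exists (e :: t :: r :: mul t r :: nil). intros g.
    destruct (classic (strict_increasing (phi g))) as [Hg|Hg].
    + destruct (Hinc g Hg) as [Hf|Hf]; [exists e | exists t]; split; simpl; auto.
      now rewrite (mul1g HG).
    + destruct (Hinc (mul r g)) as [Hf|Hf]; [now apply decreasing_mul | |].
      * exists r; split; simpl; auto.
      * exists (mul t r); split; [simpl; auto |]. now rewrite (mulA HG).
  - exists (e :: t :: nil). intros g.
    destruct (Hinc g) as [Hf|Hf].
    + apply NNPP; intros Hg. apply Hall. now exists g.
    + exists e; split; [simpl; auto |]. now rewrite (mul1g HG).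
    + exists t; split; simpl; auto.
Qed.

End SkewAction.

(** * Counting in word balls *)

Definition finite_pred {G : Type} (A : G -> Prop) : Prop :=
  exists l : list G, forall x, A x -> In x l.

(** [card] is an [epsilon] choice, so it means something only once a duplicate-free enumeration
    exists. *)
Lemma card_spec {G : Type} (A : G -> Prop) : finite_pred A ->
  exists l : list G, NoDup l /\ length l = card A /\ forall x, In x l <-> A x.
Proof.
  intros [l Hl]. unfold card. apply epsilon_spec.
  set (dec := fun x y : G => excluded_middle_informative (x = y)).
  set (f := fun x => if excluded_middle_informative (A x) then true else false).
  set (l' := nodup dec (filter f l)).
  exists (length l'), l'. repeat split.
  - apply NoDup_nodup.
  - intros Hx. apply nodup_In, filter_In in Hx as [_ Hx]. unfold f in Hx.
    now destruct (excluded_middle_informative (A x)).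
  - intros Hx. apply nodup_In, filter_In. split; [auto |]. unfold f.
    now destruct (excluded_middle_informative (A x)).
Qed.

(** The counting bound behind monotonicity of [card], submultiplicativity of ball sizes and the
    syndetic estimate. *)
Lemma card_le_image2 {G U V : Type} (f : U -> V -> G) (A : G -> Prop) (B : V -> Prop)
    (lu : list U) : finite_pred B ->
  (forall x, A x -> exists u v, In u lu /\ B v /\ f u v = x) ->
  (card A <= length lu * card B)%nat.
Proof.
  intros HB Hf. destruct (card_spec B HB) as (lB & _ & <- & HlB).
  set (img := map (fun p => f (fst p) (snd p)) (list_prod lu lB)).
  assert (Himg : forall x, A x -> In x img).
  { intros x Hx. destruct (Hf x Hx) as (u & v & Hu & Hv & <-).
    apply (in_map (fun p => f (fst p) (snd p)) _ (u, v)).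
    apply in_prod; [assumption | now apply HlB]. }
  destruct (card_spec A (ex_intro _ img Himg)) as (lA & Hnd & <- & HlA).
  rewrite <- length_prod, <- (length_map (fun p => f (fst p) (snd p))).
  apply NoDup_incl_length; [assumption |]. intros x Hx. now apply Himg, HlA.
Qed.

Lemma card_le {G : Type} (A B : G -> Prop) : finite_pred B ->
  (forall x, A x -> B x) -> (card A <= card B)%nat.
Proof.
  intros HB HAB. rewrite <- (Nat.mul_1_l (card B)).
  apply (card_le_image2 (fun (_ : unit) x => x) A B (tt :: nil) HB).
  intros x Hx. exists tt, x. repeat split; simpl; auto.
Qed.

Lemma card_pos {G : Type} (A : G -> Prop) (x : G) : finite_pred A -> A x ->
  (0 < card A)%nat.
Proof.
  intros HA Hx. destruct (card_spec A HA) as (l & _ & <- & Hl).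
  apply Hl in Hx. destruct l; simpl in *; [contradiction | lia].
Qed.

Section WordBalls.

Context {G : Type} {mul : G -> G -> G} {inv : G -> G} {e : G}.
Context (HG : group_axioms mul inv e) (S : list G).

Let ball := word_ball mul inv e S.

Lemma word_eval_app (w w' : list (bool * G)) :
  word_eval mul inv e (w ++ w') = mul (word_eval mul inv e w) (word_eval mul inv e w').
Proof.
  induction w as [|[b s] w IH]; simpl; [now rewrite (mul1g HG) |].
  now rewrite IH, (mulA HG).
Qed.

Lemma ball_finite (n : nat) : finite_pred (ball n).
Proof.
  induction n as [|n [l Hl]].
  - exists (e :: nil). intros x (w & _ & Hw & <-).
    destruct w; simpl in *; [auto | lia].
  - exists (e :: flat_map (fun s => map (mul s) l ++ map (mul (inv s)) l) S).
    intros x ([|[b s] w] & Hw & Hlen & <-); [now left |]. right.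
    assert (Hin : In (word_eval mul inv e w) l).
    { apply Hl. exists w. repeat split; simpl in Hlen; [| lia].
      intros y Hy. apply Hw. now right. }
    apply in_flat_map. exists s. split; [apply (Hw (b, s)); now left |].
    apply in_or_app. destruct b; [right | left]; now apply (in_map (mul _)).
Qed.

Lemma ball_one (n : nat) : ball n e.
Proof. exists nil. repeat split; simpl; [now intros l [] | lia]. Qed.

Lemma ball_mul (m n : nat) (g h : G) : ball m g -> ball n h -> ball (m + n) (mul g h).
Proof.
  intros (w & Hw & Hm & <-) (w' & Hw' & Hn & <-). exists (w ++ w'). repeat split.
  - intros l Hl. apply in_app_or in Hl as [Hl|Hl]; auto.
  - rewrite length_app. lia.
  - apply word_eval_app.
Qed.

Lemma ball_le (m n : nat) (g : G) : (m <= n)%nat -> ball m g -> ball n g.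
Proof. intros Hmn (w & Hw & Hm & Ew). exists w. repeat split; auto; lia. Qed.

Lemma ball_split (m n : nat) (g : G) : ball (m + n) g ->
  exists a b, ball m a /\ ball n b /\ mul a b = g.
Proof.
  intros (w & Hw & Hlen & <-).
  exists (word_eval mul inv e (firstn m w)), (word_eval mul inv e (skipn m w)).
  rewrite <- (firstn_skipn m w) in Hw. repeat split.
  - exists (firstn m w). repeat split.
    + intros l Hl. apply Hw, in_or_app. now left.
    + apply firstn_le_length.
  - exists (skipn m w). repeat split.
    + intros l Hl. apply Hw, in_or_app. now right.
    + rewrite length_skipn. lia.
  - now rewrite <- word_eval_app, firstn_skipn.
Qed.

Lemma card_ball_add (m n : nat) :
  (card (ball (m + n)) <= card (ball m) * card (ball n))%nat.
Proof.
  destruct (card_spec _ (ball_finite m)) as (l & _ & <- & Hl).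
  apply (card_le_image2 mul _ _ l (ball_finite n)).
  intros x Hx. destruct (ball_split m n x Hx) as (a & b & Ha & Hb & E).
  exists a, b. now rewrite Hl.
Qed.

Context (HS : generates mul inv e S).

Lemma list_in_ball (F : list G) : exists k, forall f, In f F -> ball k f.
Proof.
  induction F as [|f F [k Hk]]; [now exists O |].
  destruct (HS f) as (w & Hw & Ew). exists (length w + k)%nat.
  intros g [<-|Hg].
  - exists w. repeat split; auto; lia.
  - apply ball_le with k; [lia | auto].
Qed.

(* Each [g] in the ball of radius [n - k] yields [f g] in [A], and [g] is recovered
   from [f g] and [f]. *)
Lemma card_syndetic (A : G -> Prop) (F : list G) :
  (forall g, exists f, In f F /\ A (mul f g)) ->
  exists M k, forall n, (k <= n)%nat ->
    (card (ball n) <= M * card (fun g => A g /\ ball n g))%nat.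
Proof.
  intros HF. destruct (list_in_ball F) as [k Hk].
  exists (card (ball k) * length F)%nat, k. intros n Hn.
  (* Passing to radius [n - k] leaves room for the factor [f] and costs only a constant. *)
  apply Nat.le_trans with (card (ball k) * card (ball (n - k)))%nat.
  { replace n with (k + (n - k))%nat at 1 by lia. apply card_ball_add. }
  rewrite <- Nat.mul_assoc. apply Nat.mul_le_mono_l.
  apply (card_le_image2 (fun f g => mul (inv f) g)).
  - destruct (ball_finite n) as [l Hl]. exists l. intros x [_ Hx]. auto.
  - intros g Hg. destruct (HF g) as (f & Hf & HA).
    exists f, (mul f g). repeat split; auto.
    + replace n with (k + (n - k))%nat by lia. apply ball_mul; auto.
    + apply (mulKg HG).
Qed.

End WordBalls.

(** * Upper limits of comparable sequences *)

Lemma LimSup_seq_add_null (u v : nat -> R) : is_lim_seq (fun n => v n - u n) 0 ->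
  LimSup_seq v = LimSup_seq u.
Proof.
  intros Hd. apply is_lim_seq_spec in Hd.
  assert (Hclose : forall eps, 0 < eps -> exists N, forall n, (N <= n)%nat ->
    u n - eps < v n < u n + eps).
  { intros eps Heps. destruct (Hd (mkposreal eps Heps)) as [N HN]. exists N.
    intros n Hn. specialize (HN n Hn). simpl in HN.
    apply Rabs_def2 in HN. lra. }
  apply is_LimSup_seq_unique.
  assert (Hu : is_LimSup_seq u (LimSup_seq u)).
  { unfold LimSup_seq. now destruct (ex_LimSup_seq u). }
  destruct (LimSup_seq u) as [l| |]; simpl in *.
  - intros eps. assert (Heps : 0 < eps / 2) by (destruct eps; simpl; lra).
    destruct (Hclose _ Heps) as [N HN].
    destruct (Hu (mkposreal _ Heps)) as [H1 [N2 H2]]; simpl in *. split.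
    + intros N1. destruct (H1 (N + N1)%nat) as (n & Hn & Hlt).
      exists n. split; [lia |]. specialize (HN n ltac:(lia)). lra.
    + exists (N + N2)%nat. intros n Hn.
      specialize (HN n ltac:(lia)). specialize (H2 n ltac:(lia)). lra.
  - intros M N1. destruct (Hclose 1 Rlt_0_1) as [N HN].
    destruct (Hu (M + 1) (N + N1)%nat) as (n & Hn & Hlt).
    exists n. split; [lia |]. specialize (HN n ltac:(lia)). lra.
  - intros M. destruct (Hclose 1 Rlt_0_1) as [N HN].
    destruct (Hu (M - 1)) as [N1 H1].
    exists (N + N1)%nat. intros n Hn.
    specialize (HN n ltac:(lia)). specialize (H1 n ltac:(lia)). lra.
Qed.

(** The logarithms differ by at most [ln M], which vanishes after division by [n]. *)
Lemma LimSup_seq_ln_comparable (a b : nat -> nat) (M k : nat) :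
  (forall n, (k <= n)%nat -> (0 < a n <= b n)%nat /\ (b n <= M * a n)%nat) ->
  LimSup_seq (fun n => ln (INR (a n)) / INR n) = LimSup_seq (fun n => ln (INR (b n)) / INR n).
Proof.
  intros Hab. apply LimSup_seq_add_null.
  assert (HM : is_lim_seq (fun n => - ln (INR M) * / INR n) 0).
  { replace (Finite 0) with (Rbar_mult (- ln (INR M)) 0) by (simpl; f_equal; ring).
    apply is_lim_seq_scal_l.
    apply (is_lim_seq_inv _ p_infty); [apply is_lim_seq_INR | discriminate]. }
  apply is_lim_seq_le_le_loc with (2 := HM) (3 := is_lim_seq_const 0).
  (* The successor ensures [n > 0], so that [/ INR n] is positive. *)
  exists (S k). intros n Hn. destruct (Hab n ltac:(lia)) as [Ha Hb].
  assert (HMpos : (0 < M)%nat) by nia.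
  assert (Hln1 : ln (INR (a n)) <= ln (INR (b n))).
  { apply ln_le; [apply lt_0_INR; lia | apply le_INR; lia]. }
  assert (Hln2 : ln (INR (b n)) <= ln (INR M) + ln (INR (a n))).
  { rewrite <- ln_mult, <- mult_INR by (apply lt_0_INR; lia).
    apply ln_le; [apply lt_0_INR; lia | now apply le_INR]. }
  assert (Hinv : 0 < / INR n) by (apply Rinv_0_lt_compat, lt_0_INR; lia).
  unfold Rdiv. nra.
Qed.

Theorem theorem6p5 (G : Type) (mul : G -> G -> G) (inv : G -> G) (e : G)
    (HG : group_axioms mul inv e)
    (act : G -> point -> point)
    (Hact : is_action mul e act)
    (HA : anosov_like inv e act)
    (S : list G) (HS : generates mul inv e S) :
  let Free := fun g => acts_freely (act g) in
  crit_exp mul inv e S Free = crit_exp mul inv e S (fun _ => True) /\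
  Rbar_lt (Finite 0)
    (LimSup_seq (fun n =>
       INR (card (fun g => Free g /\ word_ball mul inv e S n g)) /
       INR (card (word_ball mul inv e S n)))).
Proof.
  intros Free.
  destruct (finitely_many_translates_free HG act Hact HA) as [F HF].
  destruct (card_syndetic HG S HS Free F HF) as (M & k & HMk).
  set (ball := word_ball mul inv e S) in *.
  assert (Hfin : forall A n, finite_pred (fun g => A g /\ ball n g)).
  { intros A n. destruct (ball_finite (mul := mul) (inv := inv) (e := e) S n) as [l Hl].
    exists l. intros x [_ Hx]. auto. }
  assert (Hpos : forall n, (0 < card (ball n))%nat).
  { intros n. apply card_pos with e; [apply ball_finite | apply ball_one]. }
  split.
  - apply LimSup_seq_ln_comparable with M k. intros n Hn.
    (* [crit_exp] of the whole group counts [True /\ ball n g], whose cardinality must be identified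
       with that of [ball n]. *)
    assert (Hle : (card (ball n) <= card (fun g => True /\ ball n g))%nat)
      by (apply card_le; auto).
    assert (Hge : (card (fun g => True /\ ball n g) <= card (ball n))%nat)
      by (apply card_le; [apply ball_finite | tauto]).
    assert (HFree : (card (fun g => Free g /\ ball n g) <= card (ball n))%nat)
      by (apply card_le; [apply ball_finite | tauto]).
    specialize (HMk n Hn). specialize (Hpos n). fold ball. nia.
  - assert (HM : (0 < M)%nat) by (specialize (HMk k (le_n k)); specialize (Hpos k); nia).
    (* The proportion is at least [/ INR M] for every [n >= k]. *)
    apply Rbar_lt_le_trans with (/ INR M).
    { simpl. apply Rinv_0_lt_compat, lt_0_INR, HM. }
    rewrite <- (LimSup_seq_const (/ INR M)). apply LimSup_le.
    exists k. intros n Hn. specialize (HMk n Hn). specialize (Hpos n).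
    apply le_INR in HMk. rewrite mult_INR in HMk.
    apply lt_INR in HM, Hpos. simpl in HM, Hpos. fold ball.
    apply (Rmult_le_reg_r (INR M * INR (card (ball n)))).
    + now apply Rmult_lt_0_compat.
    + field_simplify; lra.
Qed.
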